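(* There exists an absolute constant $C>0$ such that for every integer $n\ge 2$ and every $o$-symmetric convex body $K\subset\mathbb{R}^n$ there exists a GAP $\mathrm{P}(A,b)\subseteq K$ which satisfies both (i) $\displaystyle K\cap\mathbb{Z}^n\subseteq \mathrm{P}\left(A,\; (Cn)^{2n/\ln n}\, b\right)$, and (ii) $\displaystyle |K\cap\mathbb{Z}^n| < (Cn)^{2n}\,|\mathrm{P}(A,b)|.$
   Context: An $o$-symmetric convex body in $\mathbb{R}^n$ is a compact convex set $K\subset\mathbb{R}^n$ with non-empty interior and $K=-K$. A (symmetric) generalized arithmetic progression, GAP for short, is a set of the form $$\mathrm{P}(A,b)=\{A z : z\in\mathbb{Z}^n,\ |z_i|\le b_i,\ 1\le i\le n\},$$ where $A\in\mathbb{Z}^{n\times n}$ with $\det A\neq 0$, and $b\in\mathbb{R}^n$ (the entries of $b$ need not be integers). For a real $t$, $\mathrm{P}(A,tb)$ is the set with $b$ replaced by the vector $tb$. $|\cdot|$ applied to a finite set denotes its cardinality. *)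

(* Defs.v *)
From mathcomp Require Import all_boot all_order all_algebra.
From mathcomp Require Import finmap.
From mathcomp Require Import all_classical all_reals all_analysis.

Set Implicit Arguments.
Unset Strict Implicit.
Unset Printing Implicit Defensive.

Import Order.TTheory GRing.Theory Num.Theory.
Import numFieldNormedType.Exports.

Local Open Scope classical_set_scope.
Local Open Scope ring_scope.

Definition symmetric_convex_body (R : realType) (n : nat)
    (K : set 'cV[R]_n) : Prop :=
  [/\ compact K,
      convex_set (K : set (convex_lmodType 'cV[R]_n)),
      K° !=set0
    & K = [set - x | x in K]].

Definition intvec (R : realType) (n : nat) (z : 'cV[int]_n) : 'cV[R]_n :=
  map_mx intr z.

Definition int_lattice (R : realType) (n : nat) : set 'cV[R]_n :=
  range (@intvec R n).

Arguments int_lattice : clear implicits.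

(* A GAP moreover requires [\det A != 0]; this is not part of [gap] and has to
   be assumed of [A] separately. *)
Definition gap (R : realType) (n : nat) (A : 'M[int]_n) (b : 'cV[R]_n) :
    set 'cV[R]_n :=
  [set intvec R (A *m z) | z in
     [set z : 'cV[int]_n | forall i, `|(z i 0)%:~R| <= b i 0]].

(* [fset_set] is the empty finite set on infinite sets; [finite_gap] and
   [finite_lattice_points] show that this case is never met here. *)
Definition set_card (T : choiceType) (X : set T) : nat := #|` fset_set X |.

Lemma finite_intbox (R : realType) (n : nat) (b : 'cV[R]_n) :
  finite_set [set z : 'cV[int]_n | forall i, `|(z i 0)%:~R| <= b i 0].
Proof.
pose M := (\sum_i `|b i 0|).
pose N := (Num.bound M).
pose h (f : {ffun 'I_n -> 'I_(N + N).+1}) : 'cV[int]_n :=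
  \col_i ((f i)%:Z - N%:Z).
apply: (@sub_finite_set _ _ (h @` setT)); last exact/finite_image/finite_finset.
move=> z /= zb.
have zN i : `|z i 0| <= N%:Z.
  have : `|(z i 0)%:~R : R| <= N%:~R.
    apply: (le_trans (zb i)); apply: (@le_trans _ _ M).
      rewrite /M (bigD1 i) //= (le_trans (ler_norm _)) // lerDl.
      by apply: sumr_ge0.
    apply/ltW; rewrite /N -[_%:~R]/(_%:R).
    apply: archi_boundP; exact: sumr_ge0.
  by rewrite -intr_norm ler_int.
exists [ffun i => inord (absz (z i 0 + N%:Z))] => //.
apply/colP => i; rewrite mxE ffunE.
have /andP[z1 z2] : - N%:Z <= z i 0 <= N%:Z by rewrite -ler_norml.
have z0 : 0 <= z i 0 + N%:Z by rewrite -lerBlDr sub0r.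
rewrite inordK ?gez0_abs ?addrK //.
by rewrite ltnS -lez_nat gez0_abs // PoszD lerD2r.
Qed.

Lemma finite_gap (R : realType) (n : nat) (A : 'M[int]_n) (b : 'cV[R]_n) :
  finite_set (gap A b).
Proof. exact/finite_image/finite_intbox. Qed.

Lemma finite_lattice_points (R : realType) (n : nat) (K : set 'cV[R]_n) :
  compact K -> finite_set (K `&` int_lattice R n).
Proof.
move=> /compact_bounded [M [_ /(_ (M + 1))]]; rewrite ltrDl => /(_ ltr01) KM.
pose b : 'cV[R]_n := const_mx (M + 1).
apply: sub_finite_set (finite_image (@intvec R n) (finite_intbox b)).
move=> x [Kx [z _ zx]]; exists z => //= i; rewrite mxE.
have -> : (z i 0)%:~R = x i 0 by rewrite -zx mxE.
apply: le_trans (KM _ Kx).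
rewrite [leRHS]/Num.Def.normr /= mx_normrE.
by apply/bigmax_geP; right; exists (i, 0).
Qed.

(* Main.v *)
Require Import Defs.
From mathcomp Require Import all_boot all_order all_algebra.
From mathcomp Require Import finmap.
From mathcomp Require Import all_classical all_reals all_analysis.
From mathcomp Require Import ring lra zify.

(** The theorem follows from a reduction theory for lattices, once the body is
    replaced by an ellipsoid.

    By [john_ellipsoid] there is a positive definite form [q] such that [K]
    lies in the ellipsoid [q <= 1] and contains [q <= 1 / (2 n)].  By
    [reduction_exists] the integer lattice has a basis, the columns of a
    unimodular [A], reduced for [q], together with a nondecreasing sequence
    [m k] of lengths attached to it.  Take [b k = 1 / (2 n ^ 2 m k)].

    Vectors with coordinates bounded by [b] are so short that they lie in the
    small ellipsoid, hence in [K].  Conversely, the coordinates of a point of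
    [K] in the reduced basis are at most [2 ^ n / m k], because the
    Gram-Schmidt lengths of a reduced basis cannot drop faster than a geometric
    progression.  So a dilation of [b] by [2 ^ n * 2 n ^ 2] captures all lattice
    points of [K], and this is less than [(C n) ^ (2 n / ln n)], which is at
    least [exp (2 n)] times a constant ([dilation_bound]).

    Raising that dilation to the power [n] would give far too many points, so
    cardinalities are compared without it.  A lattice point with nonzero k-th
    coordinate has length at least [m k], with no loss; a pigeonhole argument
    modulo powers of two then bounds the number of lattice points of [K] by a
    product over [k] of numbers at most [max 1 (4 / m k)]
    ([lattice_point_count]).  Such a factor is at most [8 n ^ 2] times the number
    of integers between [- b k] and [b k], which gives [(8 n ^ 2) ^ n] in total
    and explains the exponent [2 n]. *)

Import Order.TTheory GRing.Theory Num.Theory.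
Import numFieldNormedType.Exports.

Local Open Scope classical_set_scope.
Local Open Scope ring_scope.

Set Implicit Arguments.
Unset Strict Implicit.
Unset Printing Implicit Defensive.

(** * Positive definite quadratic forms *)

Definition qf {R : comNzRingType} {n : nat} (Q : 'M[R]_n) (x : 'cV[R]_n) : R :=
  (x^T *m Q *m x) 0 0.

Definition posdef {R : realFieldType} {n : nat} (Q : 'M[R]_n) : Prop :=
  Q^T = Q /\ forall x, x != 0 -> 0 < qf Q x.

Lemma posdef_ge0 (R : realFieldType) n (Q : 'M[R]_n) x : posdef Q -> 0 <= qf Q x.
Proof.
case=> _ Qx; have [->|/Qx/ltW//] := eqVneq x 0.
by rewrite /qf mulmx0 mxE.
Qed.

Lemma qfD (R : comNzRingType) n (Q : 'M[R]_n) x y : Q^T = Q ->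
  qf Q (x + y) = qf Q x + (x^T *m Q *m y) 0 0 *+ 2 + qf Q y.
Proof.
move=> Qs; have yx : y^T *m Q *m x = (x^T *m Q *m y)^T.
  by rewrite !trmx_mul trmxK Qs mulmxA.
rewrite /qf [(x + y)^T]linearD /= !mulmxDl !mulmxDr yx.
have addE (A B : 'M[R]_1) : (A + B) 0 0 = A 0 0 + B 0 0 by rewrite mxE.
have trE (A : 'M[R]_1) : A^T 0 0 = A 0 0 by rewrite mxE.
by rewrite !addE trE mulr2n !addrA.
Qed.

Lemma qfZ (R : comNzRingType) n (Q : 'M[R]_n) a x : qf Q (a *: x) = a ^+ 2 * qf Q x.
Proof.
by rewrite /qf [(a *: x)^T]linearZ /= -!scalemxAl -scalemxAr scalerA mxE expr2.
Qed.

Lemma qfM (R : comNzRingType) n m (Q : 'M[R]_n) (V : 'M[R]_(n, m)) x :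
  qf Q (V *m x) = qf (V^T *m Q *m V) x.
Proof. by rewrite /qf trmx_mul !mulmxA. Qed.

Lemma posdefM (R : realFieldType) n (Q V : 'M[R]_n) : V \in unitmx ->
  posdef Q -> posdef (V^T *m Q *m V).
Proof.
move=> Vu [Qs Qp]; split; first by rewrite !trmx_mul trmxK Qs mulmxA.
move=> x x0; rewrite -qfM; apply: Qp; apply: contra_neq x0 => Vx.
by rewrite -[x](mulKmx Vu) Vx mulmx0.
Qed.

Lemma posdef_unit (R : realFieldType) n (Q : 'M[R]_n) : posdef Q -> Q \in unitmx.
Proof.
case=> Qs Qp; rewrite -row_free_unit -kermx_eq0; apply/rowV0P => v.
move=> /sub_kermxP vQ; apply/eqP/negPn/negP => v0.
have := Qp v^T; rewrite trmx_eq0 => /(_ v0).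
by rewrite /qf trmxK vQ mul0mx mxE ltxx.
Qed.

(** Cauchy-Schwarz for the scalar product of [Q], applied to [x] and to
    [e i = Q^-1 e_i], the vector that represents the i-th coordinate.  It makes
    sublevel sets of the form bounded, so that they contain finitely many
    integer vectors. *)
Lemma posdef_coord_bound (R : realFieldType) n (Q : 'M[R]_n) : posdef Q ->
  exists2 c : R, 0 <= c & forall (x : 'cV[R]_n) i, x i 0 ^+ 2 <= c * qf Q x.
Proof.
move=> pQ; have Qu := posdef_unit pQ; have [Qs Qp] := pQ.
pose e (i : 'I_n) : 'cV[R]_n := invmx Q *m delta_mx i 0.
have Qe (i : 'I_n) (x : 'cV[R]_n) : (x^T *m Q *m e i) 0 0 = x i 0.
  rewrite /e mulmxA mulmxK //.
  rewrite mxE (bigD1 i) //= !mxE !eqxx mulr1 big1 ?addr0 // => j ji.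
  by rewrite !mxE (negPf ji) mulr0.
have e_gt0 i : 0 < qf Q (e i).
  apply: Qp; apply/eqP => e0; have := Qe i (delta_mx i 0).
  rewrite e0 mulmx0 !mxE !eqxx => /eqP; by rewrite eq_sym oner_eq0.
exists (\sum_i qf Q (e i)); first by apply: sumr_ge0 => i _; apply: ltW.
move=> x i; have q0 := e_gt0 i.
(* This combination is orthogonal to [e i] for the form. *)
have : 0 <= qf Q (qf Q (e i) *: x + (- x i 0) *: e i) by exact: posdef_ge0.
rewrite qfD // [(_ *: x)^T]linearZ /= -!scalemxAl -scalemxAr !qfZ [in X in X *+ 2]mxE.
rewrite [in X in X *+ 2]mxE Qe.
have -> : qf Q (e i) ^+ 2 * qf Q x + (qf Q (e i) * (- x i 0 * x i 0)) *+ 2 +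
  (- x i 0) ^+ 2 * qf Q (e i) = qf Q (e i) * (qf Q (e i) * qf Q x - x i 0 ^+ 2).
  ring.
rewrite pmulr_rge0 // subr_ge0 => /le_trans; apply.
apply: ler_wpM2r; first exact: posdef_ge0.
by rewrite (bigD1 i) //= lerDl; apply: sumr_ge0 => j _; apply: ltW.
Qed.

Lemma finite_set_argmin d (R : orderType d) (T : choiceType) (A : set T) (f : T -> R) :
  finite_set A -> A !=set0 ->
  exists2 x, A x & forall y, A y -> (f x <= f y)%O.
Proof.
move=> /finite_seqP[s ->] [x0 /= x0s].
have : exists2 x, x \in s & forall y, y \in s -> (f x <= f y)%O.
  elim: s x0 x0s => [//|a s IH] x0 _.
  case: s IH => [|b s] IH.
    by exists a; rewrite ?mem_head // => y; rewrite inE => /eqP ->.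
  have [|x xs xm] := IH b; first exact: mem_head.
  have [fax|fxa] := leP (f a) (f x).
    exists a; rewrite ?mem_head // => y; rewrite inE => /orP[/eqP->//|/xm].
    exact: (le_trans fax).
  exists x; first by rewrite inE xs orbT.
  by move=> y; rewrite inE => /orP[/eqP->|/xm //]; apply: ltW.
by case=> x xs xm; exists x.
Qed.

Lemma intvec_eq0 (R : realType) n (z : 'cV[int]_n) :
  (intvec R z == 0) = (z == 0).
Proof.
apply/eqP/eqP => [/matrixP zE|->]; last by apply/matrixP => i j; rewrite !mxE.
apply/matrixP => i j; have := zE i j; rewrite !mxE => /eqP.
by rewrite intr_eq0 => /eqP.
Qed.

Lemma intvecM (R : realType) n m (A : 'M[int]_(n, m)) z :
  intvec R (A *m z) = map_mx intr A *m intvec R z.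
Proof. exact: map_mxM. Qed.

Lemma posdef_shortest (R : realType) n (Q : 'M[R]_n.+1) : posdef Q ->
  exists2 v : 'cV[int]_n.+1, v != 0 &
    forall z : 'cV[int]_n.+1, z != 0 -> qf Q (intvec R v) <= qf Q (intvec R z).
Proof.
move=> pQ; have [c c0 cQ] := posdef_coord_bound pQ.
pose e : 'cV[int]_n.+1 := const_mx 1.
have e0 : e != 0 by apply/eqP => /colP/(_ 0); rewrite !mxE.
pose r := c * qf Q (intvec R e).
pose A := [set z : 'cV[int]_n.+1 | z != 0 /\ qf Q (intvec R z) <= qf Q (intvec R e)].
have finA : finite_set A.
  apply: (sub_finite_set _ (finite_intbox (const_mx (1 + r) : 'cV[R]_n.+1))).
  move=> z [_ /= zr] i; have := cQ (intvec R z) i; rewrite !mxE => zi.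
  have {zi zr}: (z i 0)%:~R ^+ 2 <= r by apply: (le_trans zi); apply: ler_wpM2l.
  rewrite -real_normK ?num_real //; set u := `|_| => ur.
  have u0 : 0 <= u by exact: normr_ge0.
  nra.
have [||v [v0 vm] vmin] := @finite_set_argmin _ R _ A (fun z => qf Q (intvec R z)) => //.
  by exists e; split.
exists v => // z z0; have [ze|/ltW ez] := leP (qf Q (intvec R z)) (qf Q (intvec R e)).
  by apply: vmin.
exact: le_trans ez.
Qed.

(** * Splitting off a shortest lattice vector *)

(** Completing the square in the first variable: [w] is the rest of the
    first row of [Q] divided by the first entry, and [Q'] is the form induced
    on the orthogonal complement of the first basis vector. *)
Lemma schur_complement (R : realFieldType) n (Q : 'M[R]_(1 + n)) : posdef Q ->
  exists (w : 'rV[R]_n) (Q' : 'M[R]_n), posdef Q' /\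
  forall (a : R) x, qf Q (col_mx a%:M x) =
    Q 0 0 * (a + (w *m x) 0 0) ^+ 2 + qf Q' x.
Proof.
move=> [Qs Qp]; set d := Q 0 0.
pose r : 'rV[R]_n := ursubmx Q.
have dE : ulsubmx Q = d%:M.
  rewrite [LHS]mx11_scalar; congr (_%:M); rewrite !mxE /d.
  by congr (Q _ _); apply: val_inj.
have dlE : dlsubmx Q = r^T by rewrite /r trmx_ursub Qs.
have qE (a : R) (x : 'cV[R]_n) : qf Q (col_mx a%:M x) =
    d * a ^+ 2 + (r *m x) 0 0 * a *+ 2 + qf (drsubmx Q) x.
  have addE (A B : 'M[R]_1) : (A + B) 0 0 = A 0 0 + B 0 0 by rewrite mxE.
  have scE (b : R) : (b%:M : 'M[R]_1) 0 0 = b by rewrite mxE eqxx mulr1n.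
  have [t rx] : exists t, r *m x = t%:M.
    by exists ((r *m x) 0 0); rewrite -mx11_scalar.
  rewrite /qf -[Q in LHS]submxK dE dlE tr_col_mx mul_row_block mul_row_col.
  rewrite !mulmxDl tr_scalar_mx -[x^T *m r^T]trmx_mul -[a%:M *m r *m x]mulmxA.
  rewrite rx tr_scalar_mx -!scalar_mxM !addE !scE.
  by ring.
have d0 : 0 < d.
  have := Qp (col_mx 1%:M 0); rewrite qE mulmx0 /qf mulmx0 !mxE.
  rewrite expr1n mulr1 mul0r mul0rn !addr0; apply.
  by rewrite col_mx_eq0 negb_and (oner_neq0 'M[R]_1).
pose w := d^-1 *: r; pose Q' := drsubmx Q - d^-1 *: (r^T *m r).
have Q'E a x : qf Q (col_mx a%:M x) = d * (a + (w *m x) 0 0) ^+ 2 + qf Q' x.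
  have -> : qf Q' x = qf (drsubmx Q) x - d^-1 * (r *m x) 0 0 ^+ 2.
    rewrite /qf /Q' mulmxBr mulmxBl -scalemxAr -scalemxAl mxE; congr (_ + _).
    rewrite mxE [in LHS]mxE; congr (- (_ * _)).
    rewrite mulmxA -trmx_mul -mulmxA [r *m x]mx11_scalar tr_scalar_mx -scalar_mxM.
    by rewrite !mxE eqxx expr2.
  rewrite qE /w -scalemxAl [in RHS]mxE; move: (_ 0 0) (qf _ _) => t u.
  by field; rewrite gt_eqF.
exists w, Q'; split=> //; split.
  by rewrite /Q' linearB /= linearZ /= trmx_mul trmxK trmx_drsub Qs.
move=> x x0; have := Qp (col_mx (- (w *m x) 0 0)%:M x).
rewrite Q'E addNr expr0n /= mulr0 add0r; apply.
by rewrite col_mx_eq0 negb_and x0 orbT.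
Qed.

(** The Smith form of a column [v] is [v = c L e_1] with [L] unimodular.  The
    column [L e_1] is at most as long as [v], which is shortest, so it is
    shortest as well; in this way no primitivity of [v] has to be discussed. *)
Lemma shortest_basis_vector (R : realType) n (Q : 'M[R]_(1 + n)) : posdef Q ->
  exists2 V : 'M[int]_(1 + n), V \in unitmx &
    forall z : 'cV[int]_(1 + n), z != 0 ->
      qf Q (intvec R (V *m delta_mx 0 0)) <= qf Q (intvec R z).
Proof.
move=> pQ; have [v v0 vmin] := @posdef_shortest _ n _ pQ.
have [L Lu [M Mu [s _ vE]]] := int_Smith_normal_form (v : 'cV[int]_(1 + n)).
exists L => // z /vmin; apply: le_trans.
have vL : v = s`_0 * M 0 0 *: (L *m delta_mx 0 0).
  rewrite {1}vE {1}[M]mx11_scalar mul_mx_scalar mulrC -scalerA; congr (_ *: _).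
  rewrite scalemxAr; congr (_ *m _); apply/colP => i; rewrite !mxE eqxx andbT.
  by rewrite -val_eqE /=; case: eqP => [->|_]; rewrite ?mulr1 ?mulr0.
have c0 : s`_0 * M 0 0 != 0 by apply: contraNneq v0 => c0; rewrite vL c0 scale0r.
rewrite {}[v in leRHS]vL; set c := s`_0 * M 0 0 in c0 *; set x := L *m _.
have -> : intvec R (c *: x) = c%:~R *: intvec R x.
  by apply/colP => i; rewrite !mxE intrM.
rewrite qfZ ler_peMl ?posdef_ge0 // -real_normK ?num_real // exprn_ege1 //.
by rewrite -intr_norm ler1z -gtz0_ge1 normr_gt0.
Qed.

(** One step of the reduction: in a basis of the integer lattice that starts
    with a shortest vector, of squared length [d], the form is a square in the
    first coordinate plus a form in one variable less. *)
Lemma reduction_step (R : realType) n (Q : 'M[R]_(1 + n)) : posdef Q ->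
  exists (V : 'M[int]_(1 + n)) (d : R) (w : 'rV[R]_n) (Q' : 'M[R]_n),
  [/\ V \in unitmx, 0 < d,
      forall z : 'cV[int]_(1 + n), z != 0 -> d <= qf Q (intvec R z),
      posdef Q' &
      forall (a : int) x, qf Q (intvec R (V *m col_mx a%:M x)) =
        d * (a%:~R + (w *m intvec R x) 0 0) ^+ 2 + qf Q' (intvec R x)].
Proof.
move=> pQ; have [V Vu Vmin] := shortest_basis_vector pQ.
pose VR : 'M[R]_(1 + n) := map_mx intr V.
have VRu : VR \in unitmx by rewrite unitmxE det_map_mx rmorph_unit -?unitmxE.
have pQ1 := posdefM VRu pQ.
have [w [Q' [pQ' Q'E]]] := schur_complement pQ1.
have dE : (VR^T *m Q *m VR) 0 0 = qf Q (intvec R (V *m delta_mx 0 0)).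
  rewrite intvecM qfM /qf /intvec map_delta_mx.
  by rewrite trmx_delta -rowE -colE !mxE.
exists V, (qf Q (intvec R (V *m delta_mx 0 0))), w, Q'; split=> //.
  apply: (pQ.2); rewrite intvec_eq0; apply/eqP => V0.
  have := congr1 (mulmx (invmx V)) V0; rewrite mulKmx // mulmx0.
  by move=> /colP/(_ 0)/eqP; rewrite !mxE eqxx oner_eq0.
move=> a x; rewrite intvecM qfM -dE -Q'E; congr (qf _ _).
rewrite /intvec map_col_mx; congr col_mx.
by apply/matrixP => i j; rewrite !mxE; case: eqP.
Qed.

(** * Reduced bases *)

(** A basis, the columns of [A], reduced in the sense of Hermite, Korkine and
    Zolotarev.  The number [m k] stands for the largest length of the
    Gram-Schmidt vectors up to index [k]; unlike these lengths, it is monotone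
    in [k], and up to the polynomial factor seen here it is the length of the
    k-th basis vector.  [reduced_upper] says that small coordinates give a short
    vector, [reduced_lower] and [reduced_coord] are two converses: the former
    loses nothing but only sees whether a coordinate vanishes, the latter bounds
    all coordinates but loses an exponential factor.  [reduced_min] is what the
    induction on the dimension needs: it compares [m] with the length of the
    vector chosen one step earlier. *)
Record reduced {R : realType} {n : nat} (Q : 'M[R]_n) (A : 'M[int]_n)
    (m : 'I_n -> R) : Prop := Reduced {
  reduced_unit : A \in unitmx;
  reduced_gt0 : forall k, 0 < m k;
  reduced_mono : forall i j : 'I_n, (i <= j)%N -> m i <= m j;
  reduced_min : forall c, (forall z : 'cV[int]_n, z != 0 -> c <= qf Q (intvec R z)) ->
    forall k, c <= m k ^+ 2;
  reduced_upper : forall (z : 'cV[int]_n) beta,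
    (forall k, `|(z k 0)%:~R| * m k <= beta) ->
    qf Q (intvec R (A *m z)) <= n%:R ^+ 3 * beta ^+ 2;
  reduced_lower : forall (z : 'cV[int]_n) k, z k 0 != 0 ->
    m k ^+ 2 <= qf Q (intvec R (A *m z));
  reduced_coord : forall (z : 'cV[int]_n) r, 0 <= r ->
    qf Q (intvec R (A *m z)) <= r ^+ 2 ->
    \sum_k `|(z k 0)%:~R| * m k <= (2 ^+ n - 1) * r }.

Lemma near_int (R : archiRealFieldType) (x : R) : exists s : int, `|x + s%:~R| <= 2^-1.
Proof.
exists (- Num.floor (x + 2^-1)); have := floor_itv (x + 2^-1).
rewrite intrN intrD => /andP[h1 h2]; rewrite ler_norml; move: h1 h2.
rewrite -[1%:~R]/(1 : R).
by move=> h1 h2; apply/andP; split; lra.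
Qed.

Lemma mulmx_row_le (R : numDomainType) n (u : 'rV[R]_n) (x : 'cV[R]_n) c :
  (forall j, `|u 0 j| <= c) -> `|(u *m x) 0 0| <= c * \sum_j `|x j 0|.
Proof.
move=> uc; rewrite mxE (le_trans (ler_norm_sum _ _ _)) // mulr_sumr.
by apply: ler_sum => j _; rewrite normrM ler_wpM2r.
Qed.

(** The basis is built by induction: take a shortest vector, reduce the form on
    the orthogonal complement, and lift the reduced basis with integer
    translations that leave entries [u] of size at most 1/2.  Because the first
    vector is shortest, the minimum of the induced form [Q'] is at least 3/4 of
    [d]; hence the Gram-Schmidt lengths drop by a bounded factor, and passing
    from [m'] to [m] costs at most 4/3.  For [reduced_coord] this turns a bound
    [t] for the sum in one dimension less into [1 + 3/2 * 4/3 * t], whence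
    [2 ^+ n - 1]. *)
Lemma reduction_exists (R : realType) n (Q : 'M[R]_n) : posdef Q ->
  exists (A : 'M[int]_n) (m : 'I_n -> R), reduced Q A m.
Proof.
elim: n Q => [|n IH] Q pQ.
  exists 1%:M, (fun=> 1); split.
  - exact: unitmx1.
  - by case.
  - by case.
  - by move=> c _ [].
  - move=> z b _; rewrite /qf mxE big_ord0 expr0n mul0r //.
  - by move=> z [].
  - by move=> z r r0 _; rewrite big_ord0 expr0 subrr mul0r.
have [V [d [w [Q' [Vu d0 dmin pQ' QE]]]]] := @reduction_step _ n Q pQ.
have [A' [m' red']] := IH Q' pQ'.
have /choice[s sP] : forall j, exists s : int,
    `|(w *m map_mx intr A') 0 j + s%:~R| <= 2^-1 by move=> j; exact: near_int.
pose sv : 'rV[int]_n := \row_j s j.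
pose u : 'rV[R]_n := w *m map_mx intr A' + map_mx intr sv.
have uh j : `|u 0 j| <= 2^-1 by rewrite /u mxE [map_mx _ sv _ _]mxE [sv _ _]mxE.
pose A : 'M[int]_(1 + n) := V *m block_mx 1%:M sv 0 A'.
have AE (z : 'cV[int]_(1 + n)) : qf Q (intvec R (A *m z)) =
    d * ((z 0 0)%:~R + (u *m intvec R (dsubmx z)) 0 0) ^+ 2 +
    qf Q' (intvec R (A' *m dsubmx z)).
  have zE : z = col_mx (z 0 0)%:M (dsubmx z).
    rewrite -{1}[z]vsubmxK; congr col_mx; rewrite [LHS]mx11_scalar.
    by congr (_%:M); rewrite !mxE; congr (z _ _); apply: val_inj.
  rewrite {1}zE /A -mulmxA mul_block_col mul1mx mul0mx add0r.
  rewrite [sv *m _]mx11_scalar -raddfD /= QE; congr (d * _ ^+ 2 + _).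
  rewrite intrD -addrA; congr (_ + _); rewrite /u mulmxDl [in RHS]mxE addrC.
  congr (_ + _); first by rewrite intvecM mulmxA.
  by rewrite -map_mxM [in RHS]mxE.
pose m0 := Num.sqrt d.
have m0_gt0 : 0 < m0 by rewrite sqrtr_gt0.
have m0E : m0 ^+ 2 = d by rewrite sqr_sqrtr // ltW.
pose m (k : 'I_(1 + n)) : R :=
  match fintype.split k with inl _ => m0 | inr j => Num.max m0 (m' j) end.
have mE0 : m 0 = m0.
  by rewrite /m; case: splitP.
have mE j : m (rshift 1 j) = Num.max m0 (m' j).
  rewrite /m; case: splitP => [k /= jk|k /= [jk]].
    by have := ltn_ord k; lia.
  by congr (Num.max _ (m' _)); apply: val_inj.
have Q'min (z : 'cV[int]_n) : z != 0 -> 3 / 4 * d <= qf Q' (intvec R z).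
  move=> z0; have [t tP] := near_int ((w *m intvec R z) 0 0).
  have := dmin (V *m col_mx t%:M z); rewrite QE.
  set y := (X in X ^+ 2); have yh : y ^+ 2 <= 1 / 4.
    have : `|y| <= 2^-1 by rewrite /y addrC.
    by rewrite ler_norml => /andP[? ?]; nra.
  have V0 : V *m col_mx t%:M z != 0.
    apply: contraNneq z0 => V0; have := mulKmx Vu (col_mx t%:M z).
    by rewrite V0 mulmx0 => /esym/eqP; rewrite col_mx_eq0 => /andP[].
  by move=> /(_ V0); nra.
have m'_gt0 k : 0 < m' k := reduced_gt0 red' k.
(* 4/3 exceeds the square root of 4/3, so no radical is needed. *)
have m0_le k : m0 <= 4 / 3 * m' k.
  have := reduced_min red' Q'min k; rewrite -m0E; have := m'_gt0 k; nra.
have sumE (F : 'I_(1 + n) -> R) : \sum_k F k = F 0 + \sum_j F (rshift 1 j).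
  rewrite big_ord_recl; congr (_ + _).
  by apply: eq_bigr => j _; rewrite rshift1.
have ordP (P : 'I_(1 + n) -> Prop) : P 0 -> (forall j, P (rshift 1 j)) -> forall k, P k.
  move=> P0 PS k; case: (split_ordP k) => j -> //.
  by rewrite (_ : lshift n j = 0) //; apply: val_inj; rewrite /= (ord1 j).
have m_ge0 : forall k, m0 <= m k.
  by apply: (ordP) => [|j]; rewrite ?mE0 // mE le_max lexx.
have m_gt0 k : 0 < m k by exact: lt_le_trans (m_ge0 k).
have zS (z : 'cV[int]_(1 + n)) j : dsubmx z j 0 = z (rshift 1 j) 0 by rewrite mxE.
have normu (z : 'cV[int]_n) :
   `|(u *m intvec R z) 0 0| <= 2^-1 * \sum_j `|(z j 0)%:~R|.
  rewrite (le_trans (mulmx_row_le _ uh)) //.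
  by under eq_bigr do rewrite mxE.
have qge0 z : 0 <= qf Q' (intvec R z) by exact: posdef_ge0.
have Au : A \in unitmx.
  have Bu : block_mx 1%:M sv 0 A' \in unitmx.
    by rewrite unitmxE det_ublock det1 mul1r -unitmxE; exact: reduced_unit red'.
  by rewrite unitmx_mul Vu.
exists A, m; split=> //.

- apply: (ordP) => [|i] j; first by rewrite mE0.
  move: j; apply: (ordP) => [|j] //= ij.
  by rewrite !mE ge_max !le_max lexx (reduced_mono red') ?orbT.
- move=> c cmin k; apply: (@le_trans _ _ (m0 ^+ 2)); last first.
    by rewrite ler_pXn2r ?nnegrE ?(ltW m0_gt0) ?(ltW (m_gt0 k)).
  have i0 : intvec R (0 : 'cV_n) = 0 by apply/eqP; rewrite intvec_eq0.
  have := cmin (V *m col_mx 1%:M 0); rewrite QE i0 mulmx0 /qf mulmx0 !mxE.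
  rewrite !addr0 expr1n mulr1 m0E; apply; apply/eqP => V0.
  have := mulKmx Vu (col_mx 1%:M 0); rewrite V0 mulmx0 => /esym/eqP.
  by rewrite col_mx_eq0 (negPf (oner_neq0 'M[int]_1)).
- move=> z b zb; rewrite AE.
  set z' := dsubmx (z : 'cV[int]_(1 + n)); pose S := \sum_j `|(z' j 0)%:~R : R|.
  have b0 : 0 <= b by apply: le_trans (zb 0); rewrite mulr_ge0 // ltW.
  have S0 : 0 <= S by apply: sumr_ge0.
  have m0S : m0 * S <= n%:R * b.
    rewrite /S mulr_sumr mulr_natl -[in leRHS](card_ord n) -sumr_const.
    apply: ler_sum => j _; rewrite zS mulrC; apply: le_trans (zb (rshift 1 j)).
    by rewrite ler_wpM2l.
  have q'b : qf Q' (intvec R (A' *m z')) <= n%:R ^+ 3 * b ^+ 2.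
    apply: (reduced_upper red') => j; rewrite zS; apply: le_trans (zb (rshift 1 j)).
    by rewrite ler_wpM2l // mE le_max lexx orbT.
  have hd : d * ((z 0 0)%:~R + (u *m intvec R z') 0 0) ^+ 2 <= ((n%:R + 1) * b) ^+ 2.
    rewrite -m0E -exprMn -[leLHS]real_normK ?num_real // ler_pXn2r ?nnegrE ?mulr_ge0 //.
    rewrite normrM (gtr0_norm m0_gt0) mulrC.
    apply: (@le_trans _ _ ((`|(z 0 0)%:~R| + 2^-1 * S) * m0)).
      rewrite ler_wpM2r ?(ltW m0_gt0) // (le_trans (ler_normD _ _)) //.
      by rewrite lerD2l normu.
    have := zb 0; rewrite mE0; nra.
  apply: le_trans (lerD hd q'b) _.
  rewrite -natr1 exprMn -mulrDl ler_wpM2r ?sqr_ge0 //.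
  have : 0 <= n%:R :> R by []; nra.
- move=> z k zk.
  have z0 : z != 0 by apply: contraNneq zk => ->; rewrite mxE.
  have dq : d <= qf Q (intvec R (A *m z)).
    apply: dmin; apply: contraNneq z0 => Az.
    by have := mulKmx Au z; rewrite Az mulmx0 => <-.
  move: k zk; apply: (ordP) => [|j]; first by rewrite mE0 m0E.
  rewrite -zS mE => zj; rewrite maxEle; case: ifP => _; last by rewrite m0E.
  apply: le_trans (reduced_lower red' zj) _.
  by rewrite AE lerDr mulr_ge0 ?sqr_ge0 // ltW.
- move=> z r r0; rewrite AE sumE.
  set z' := dsubmx (z : 'cV[int]_(1 + n)); set y := (X in X ^+ 2) => qr.
  pose S := \sum_j `|(z' j 0)%:~R : R|.
  pose T := \sum_j `|(z (rshift 1 j) 0)%:~R| * m (rshift 1 j).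
  have dy0 : 0 <= d * y ^+ 2 by rewrite mulr_ge0 ?sqr_ge0 ?ltW.
  have q'0 := qge0 (A' *m z').
  have hT : T <= 4 / 3 * ((2 ^+ n - 1) * r).
    have hc : \sum_j `|(z' j 0)%:~R| * m' j <= (2 ^+ n - 1) * r.
      by apply: (reduced_coord red' r0); lra.
    apply: (@le_trans _ _ (4 / 3 * \sum_j `|(z' j 0)%:~R| * m' j)); last first.
      by rewrite ler_wpM2l.
    rewrite mulr_sumr; apply: ler_sum => j _; rewrite zS mulrCA ler_wpM2l // mE.
    rewrite ge_max m0_le /=.
    by have := m'_gt0 j; lra.
  have m0S : m0 * S <= T.
    rewrite /S mulr_sumr; apply: ler_sum => j _; rewrite zS mulrC.
    by rewrite ler_wpM2l.
  have hy : m0 * `|y| <= r.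
    rewrite -(@ler_pXn2r _ 2) ?nnegrE ?mulr_ge0 ?(ltW m0_gt0) //.
    by rewrite exprMn m0E real_normK ?num_real //; lra.
  have hz : `|(z 0 0)%:~R| <= `|y| + 2^-1 * S.
    have -> : (z 0 0)%:~R = y - (u *m intvec R z') 0 0 by rewrite /y addrK.
    by rewrite (le_trans (ler_normB _ _)) // lerD2l normu.
  rewrite mE0 exprS -/T; set X := (2 ^+ n : R) in hT *.
  nra.
Qed.

(** * Gram determinants and symmetric convex bodies *)

(** Both sides are the determinant of a product of the same two unitriangular
    block matrices, in one order and in the other. *)
Lemma det_1addmx (R : comNzRingType) m n (A : 'M[R]_(m, n)) (B : 'M[R]_(n, m)) :
  \det (1%:M + A *m B) = \det (1%:M + B *m A).
Proof.
pose X := block_mx 1%:M A 0 1%:M; pose Y := block_mx 1%:M (- A) B 1%:M.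
have : \det (X *m Y) = \det (Y *m X) by rewrite !det_mulmx mulrC.
rewrite !mulmx_block !mul1mx !mul0mx !mulmx1 !mulmx0 !add0r !addr0 addNr addrN.
by rewrite addrC [in RHS]addrC det_lblock det_lblock !det1 mulr1 mul1r.
Qed.

Lemma det_mx22 (R : comNzRingType) (M : 'M[R]_2) :
  \det M = M 0 0 * M 1 1 - M 0 1 * M 1 0.
Proof.
rewrite (expand_det_row M 0) !big_ord_recl big_ord0 addr0 /cofactor !det_mx11 !mxE /=.
rewrite addn0 expr0 mul1r expr1 mulN1r mulrN.
by congr (_ * M _ _ - M _ _ * M _ _); apply: val_inj.
Qed.

Lemma det_block_mx11 (R : comNzRingType) (a b c d : 'M[R]_1) :
  \det (block_mx a b c d) = a 0 0 * d 0 0 - b 0 0 * c 0 0.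
Proof.
rewrite (det_mx22 (block_mx a b c d)).
congr (_ * _ - _ * _).
- by rewrite -(block_mxEul a b c d); congr (block_mx _ _ _ _ _ _); apply: val_inj.
- by rewrite -(block_mxEdr a b c d); congr (block_mx _ _ _ _ _ _); apply: val_inj.
- by rewrite -(block_mxEur a b c d); congr (block_mx _ _ _ _ _ _); apply: val_inj.
- by rewrite -(block_mxEdl a b c d); congr (block_mx _ _ _ _ _ _); apply: val_inj.
Qed.

(** This measures the effect on a Gram determinant of exchanging one vector for
    another: a rank two update, reduced to a 2 by 2 determinant. *)
Lemma det_exchange (R : comUnitRingType) n (S : 'M[R]_n) (x y : 'cV[R]_n) :
  S \in unitmx -> S^T = S -> let Q := invmx S in
  \det (S + y *m y^T - x *m x^T) = \det S *
    ((1 + qf Q y) * (1 - qf Q x) + ((y^T *m Q *m x) 0 0) ^+ 2).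
Proof.
move=> Su Ss Q.
have -> : S + y *m y^T - x *m x^T =
    S *m (1%:M + (Q *m row_mx y x) *m col_mx y^T (- x^T)).
  by rewrite mulmxDr mulmx1 !mulmxA mulmxV // mul1mx mul_row_col mulmxN addrA.
rewrite det_mulmx det_1addmx; congr (_ * _).
have Qs : Q^T = Q by rewrite trmx_inv Ss.
have xy : x^T *m (Q *m y) = (y^T *m Q *m x)^T.
  by rewrite !trmx_mul trmxK Qs.
rewrite mul_mx_row mul_col_row scalar_mx_block add_block_mx det_block_mx11.
have addE (A B : 'M[R]_1) : (A + B) 0 0 = A 0 0 + B 0 0 by rewrite mxE.
have oppE (A : 'M[R]_1) : (- A) 0 0 = - A 0 0 by rewrite mxE.
have trE (A : 'M[R]_1) : A^T 0 0 = A 0 0 by rewrite mxE.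
have oneE : (1%:M : 'M[R]_1) 0 0 = 1 by rewrite mxE.
rewrite !mulNmx xy !add0r !addE !oppE trE oneE !mulmxA /qf.
by ring.
Qed.

Lemma continuous_sumr (R : realType) (T : topologicalType) I (r : seq I)
    (F : I -> T -> R) :
  (forall i, continuous (F i)) -> continuous (fun x => \sum_(i <- r) F i x).
Proof.
move=> cF; apply: (@continuous_big R I +%R 0 xpredT (@add_continuous R^o)) => i _ x.
exact: cF.
Qed.

Lemma continuous_prodr (R : realType) (T : topologicalType) I (r : seq I)
    (F : I -> T -> R) :
  (forall i, continuous (F i)) -> continuous (fun x => \prod_(i <- r) F i x).
Proof.
move=> cF; apply: (@continuous_big R I *%R 1 xpredT (@mul_continuous R)) => i _ x.
exact: cF.
Qed.

Lemma continuous_mulr (R : realType) (T : topologicalType) (f g : T -> R) :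
  continuous f -> continuous g -> continuous (fun x => f x * g x).
Proof. by move=> cf cg x; exact: (cvgM (cf x) (cg x)). Qed.

Definition gram {R : comNzRingType} {n N : nat} (v : 'I_N -> 'cV[R]_n) : 'M[R]_n :=
  \sum_k v k *m (v k)^T.

Lemma continuous_det_gram (R : realType) n N :
  continuous (fun v : prod_topology (fun _ : 'I_N => 'cV[R]_n) =>
    \det (gram v)).
Proof.
pose X := prod_topology (fun _ : 'I_N => 'cV[R]_n).
have c k j : continuous (fun v : X => v k j 0).
  move=> v; apply: (@continuous_comp _ _ _ (fun v : X => v k)
    (fun x : 'cV[R]_n => x j 0)).
    exact: (@proj_continuous _ _ k).
  exact: coord_continuous.
have cS i j : continuous (fun v : X => (\sum_k v k *m (v k)^T) i j).
  rewrite (_ : (fun v => _) = fun v : X => \sum_k v k i 0 * v k j 0).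
    by apply: continuous_sumr => k; apply: continuous_mulr; exact: c.
  apply/funext => v; rewrite summxE; apply: eq_bigr => k _.
  by rewrite !mxE big_ord1 mxE.
apply: continuous_sumr => s; apply: continuous_mulr; first exact: cst_continuous.
by apply: continuous_prodr => i; exact: cS.
Qed.

Lemma symmetric_convex (R : realType) n (K : set 'cV[R]_n) x y t :
  symmetric_convex_body K -> K x -> K y -> 0 <= t -> t <= 1 ->
  K (t *: x + (1 - t) *: y).
Proof.
move=> [_ Kc _ _] Kx Ky t0 t1.
by have := Kc x y (Itv01 t0 t1); rewrite !inE; apply.
Qed.

Lemma symmetric_opp (R : realType) n (K : set 'cV[R]_n) x :
  symmetric_convex_body K -> K x -> K (- x).
Proof. by move=> [_ _ _ KE] Kx; rewrite KE; exists x. Qed.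

(** Around an interior point [x0], every [x0 + 2 x] with small [x] is in [K];
    [x] is the midpoint of this point and [- x0]. *)
Lemma symmetric_ball (R : realType) n (K : set 'cV[R]_n) : symmetric_convex_body K ->
  exists2 e : R, 0 < e & forall x : 'cV[R]_n, `|x| < e -> K x.
Proof.
move=> Ks; have [_ _ [x0 Kx0] _] := Ks.
have /nbhs_ballP[e e0 eK] : nbhs x0 K by exact: Kx0.
exists (e / 2); first by rewrite divr_gt0.
move=> x xe.
have K1 : K (x0 + 2 *: x).
  apply: eK; rewrite -ball_normE /= opprD addNKr normrN normrZ ger0_norm //.
  by rewrite mulrC -ltr_pdivlMr.
have K2 : K (- x0) by apply: symmetric_opp => //; apply: eK; apply: ballxx.
have -> : x = 2^-1 *: (x0 + 2 *: x) + (1 - 2^-1) *: (- x0).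
  by apply/colP => i; rewrite !mxE; field.
by apply: symmetric_convex => //; lra.
Qed.

(** * An ellipsoid approximating a symmetric convex body *)

Lemma symmetric_0 (R : realType) n (K : set 'cV[R]_n) :
  symmetric_convex_body K -> K 0.
Proof. by move=> /symmetric_ball[e e0]; apply; rewrite normr0. Qed.

(** By induction the combination is a point of [K] scaled by the sum of the
    absolute values of the weights; only this sharper form is inductive. *)
Lemma abs_convex_sum (R : realType) n (K : set 'cV[R]_n) N
    (v : 'I_N -> 'cV[R]_n) (w : 'I_N -> R) :
  symmetric_convex_body K -> (forall k, K (v k)) -> \sum_k `|w k| <= 1 ->
  K (\sum_k w k *: v k).
Proof.
move=> Ks Kv.
have [y Ky ->] : exists2 y, K y & \sum_k w k *: v k = (\sum_k `|w k|) *: y.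
  elim: N v w Kv => [|N IH] v w Kv.
    exists 0; first exact: symmetric_0.
    by rewrite scaler0 big_ord0.
  have [y' Ky' sE] := IH (v \o lift ord0) (w \o lift ord0) (fun k => Kv _).
  rewrite !big_ord_recl /= sE; set W := \sum_(i < N) _.
  have W0 : 0 <= W by apply: sumr_ge0.
  have [y0 Ky0 ->] : exists2 y0, K y0 & w ord0 *: v ord0 = `|w ord0| *: y0.
    have [w0|w0] := ger0P (w ord0); first by exists (v ord0).
    by exists (- v ord0); [exact: symmetric_opp|rewrite scalerN scaleNr opprK].
  have [T0|T0] := eqVneq (`|w ord0| + W) 0.
    have [-> ->] : `|w ord0| = 0 /\ W = 0 by have := normr_ge0 (w ord0); split; lra.
    exists 0; first exact: symmetric_0.
    by rewrite !scale0r addr0 scaler0.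
  have Tp : 0 < `|w ord0| + W by rewrite lt_def T0 addr_ge0.
  set T := `|w ord0| + W in T0 Tp *.
  exists (`|w ord0| / T *: y0 + (1 - `|w ord0| / T) *: y').
    apply: symmetric_convex => //; first by rewrite divr_ge0 // ltW.
    by rewrite ler_pdivrMr // mul1r lerDl.
  have WE : W = T - `|w ord0| by rewrite /T addrC addKr.
  by apply/colP => i; rewrite !mxE WE; field.
move=> W1; set W := \sum_k _ in W1 *.
rewrite -[W *: y]addr0 -(scaler0 _ (1 - W)).
by apply: symmetric_convex => //; [exact: symmetric_0|apply: sumr_ge0].
Qed.

Lemma gram_pos (R : realType) n (K : set 'cV[R]_n) : symmetric_convex_body K ->
  exists2 v : 'I_(n + n) -> 'cV[R]_n, (forall k, K (v k)) & 0 < \det (gram v).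
Proof.
move=> /symmetric_ball[e e0 eK].
pose t := e / 2; have t0 : 0 < t by rewrite divr_gt0.
have Kt i : K (t *: delta_mx i 0).
  apply: eK; rewrite normrZ gtr0_norm //.
  have : `|delta_mx i 0 : 'cV[R]_n| <= 1.
    rewrite [leLHS]/Num.Def.normr /= mx_normrE.
    apply/bigmax_leP; split=> // -[a b] _ /=.
    by rewrite mxE; case: (_ && _); rewrite ?normr1 ?normr0.
  by rewrite /t; nra.
pose v (k : 'I_(n + n)) : 'cV[R]_n :=
  t *: delta_mx (match fintype.split k with inl i => i | inr i => i end) 0.
exists v => [k|]; first exact: Kt.
have vl i : v (lshift n i) = t *: delta_mx i 0.
  by rewrite /v -[lshift n i]/(unsplit (inl i)) unsplitK.
have vr i : v (rshift n i) = t *: delta_mx i 0.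
  by rewrite /v -[rshift n i]/(unsplit (inr i)) unsplitK.
have -> : gram v = (t ^+ 2 + t ^+ 2)%:M.
  have dd (i : 'I_n) : (t *: delta_mx i 0 : 'cV[R]_n) *m (t *: delta_mx i 0)^T =
      t ^+ 2 *: delta_mx i i.
    by rewrite linearZ /= -scalemxAl -scalemxAr scalerA trmx_delta mul_delta_mx.
  rewrite /gram big_split_ord /=.
  under eq_bigr do rewrite vl dd.
  under [X in _ + X]eq_bigr do rewrite vr dd.
  by rewrite -!scaler_sumr -mx1_sum_delta -scalerDl scalemx1.
by rewrite det_scalar exprn_gt0 // addr_gt0 ?exprn_gt0.
Qed.

Lemma gram_max (R : realType) n (K : set 'cV[R]_n) : symmetric_convex_body K ->
  exists v : 'I_(n + n) -> 'cV[R]_n, [/\ forall k, K (v k), 0 < \det (gram v) &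
    forall v' : 'I_(n + n) -> 'cV[R]_n, (forall k, K (v' k)) ->
      \det (gram v') <= \det (gram v)].
Proof.
move=> Ks; have [v0 Kv0 v0p] := gram_pos Ks.
pose X := prod_topology (fun _ : 'I_(n + n) => 'cV[R]_n).
pose A : set X := [set v : X | forall k, K (v k)].
have cA : compact A.
  have [Kc _ _ _] := Ks.
  exact: (@tychonoff _ _ (fun _ : 'I_(n + n) => K) (fun _ => Kc)).
have [|] := compact_EVT_max _ cA
  (continuous_subspaceT (@continuous_det_gram R n (n + n))).
  by exists v0.
move=> v; rewrite inE => Kv vmax; exists v.
have vm (v' : 'I_(n + n) -> 'cV[R]_n) : (forall k, K (v' k)) ->
    \det (gram v') <= \det (gram v).
  by move=> Kv'; apply: vmax; rewrite inE.
by split=> //; apply: lt_le_trans (vm _ Kv0).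
Qed.

(** A substitute for the theorem of John, weaker by a factor sqrt 2, that only
    uses compactness.  Choose [2 n] points of [K] that maximize the determinant
    of [S], the sum of the [v k *m (v k)^T], and let [Q] be the inverse of [S].
    The numbers [qf Q (v k)] add up to the trace of the identity, [n], so one
    of the points has [qf Q (v j) <= 1/2].  Exchanging it for [y] in [K] does
    not increase the determinant, which by [det_exchange] forces [qf Q y <= 1].
    On the other hand, every [x] is the combination of the [v k] with weights
    [c x k], whose squares add up to [qf Q x].  With [n] points instead of
    [2 n], the factor between the two ellipsoids would be [n], too much for the
    bound on cardinalities. *)
Lemma john_ellipsoid (R : realType) n (K : set 'cV[R]_n) : (0 < n)%N ->
  symmetric_convex_body K ->
  exists Q : 'M[R]_n, [/\ posdef Q, forall x, K x -> qf Q x <= 1 &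
    forall x, (n + n)%:R * qf Q x <= 1 -> K x].
Proof.
move=> n0 Ks; have [v [Kv detS vmax]] := gram_max Ks.
set S := gram v in detS vmax.
have Su : S \in unitmx by rewrite unitmxE unitfE gt_eqF.
have Ss : S^T = S.
  by rewrite /S /gram linear_sum /=; apply: eq_bigr => k _; rewrite trmx_mul trmxK.
pose Q := invmx S; have Qs : Q^T = Q by rewrite trmx_inv Ss.
pose c (x : 'cV[R]_n) k : R := ((v k)^T *m Q *m x) 0 0.
have xE x : x = \sum_k c x k *: v k.
  rewrite -{1}[x](mulKVmx Su) /S /gram mulmx_suml; apply: eq_bigr => k _.
  by rewrite -mulmxA [_^T *m _]mx11_scalar mulmxA mul_mx_scalar.
have qE x : qf Q x = \sum_k c x k ^+ 2.
  rewrite /qf {2}[x]xE mulmx_sumr summxE; apply: eq_bigr => k _.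
  rewrite -scalemxAr mxE expr2; congr (_ * _).
  have trE (A : 'M[R]_1) : A^T 0 0 = A 0 0 by rewrite mxE.
  by rewrite /c -[LHS]trE !trmx_mul trmxK Qs mulmxA.
have pQ : posdef Q.
  split=> // x x0; rewrite lt_def qE sumr_ge0 ?andbT.
    2: by move=> k _; exact: sqr_ge0.
  apply: contra_neq x0 => /eqP; rewrite psumr_eq0; last by move=> k _; exact: sqr_ge0.
  move=> /allP c0; rewrite [x]xE big1 // => k _.
  by have := c0 k (mem_index_enum k); rewrite sqrf_eq0 => /eqP ->; rewrite scale0r.
have [j hj] : exists j, qf Q (v j) <= 2^-1.
  have hs : \sum_k qf Q (v k) = n%:R.
    rewrite -(mxtrace1 R n) -(mulVmx Su) -/Q /S /gram mulmx_sumr linear_sum /=.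
    apply: eq_bigr => k _; rewrite mulmxA mxtrace_mulC mulmxA /qf.
    by rewrite [in RHS]/mxtrace big_ord1.
  apply: contrapT => /forallNP h.
  have h' k : 0 < qf Q (v k) - 2^-1 by rewrite subr_gt0 ltNge; apply/negP.
  have : \sum_k (qf Q (v k) - 2^-1) = 0.
    rewrite sumrB hs sumr_const card_ord mulrnDr -mulr_natl; lra.
  move/eqP; rewrite psumr_eq0 => [/allP h0|k _]; last exact: ltW.
  pose k : 'I_(n + n) := Ordinal (ltn_addr n n0).
  by have := h0 k (mem_index_enum k); rewrite gt_eqF.
exists Q; split=> // [y Ky|x qx].
- pose v' k := if k == j then y else v k.
  have : \det (gram v') <= \det S.
    by apply: vmax => k; rewrite /v'; case: eqP.
  have -> : gram v' = S + y *m y^T - v j *m (v j)^T.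
    rewrite /S /gram (bigD1 j) //= [in RHS](bigD1 j) //= /v' eqxx.
    under eq_bigr => k kj do rewrite (negPf kj).
    by rewrite [in RHS]addrAC (addrC (v j *m _)) addrK addrC.
  rewrite det_exchange // -/Q ger_pMr //.
  have := posdef_ge0 y pQ; set g := qf Q y; set h := qf Q (v j) in hj *.
  have := sqr_ge0 ((y^T *m Q *m v j) 0 0); set c2 := _ ^+ 2.
  by nra.
- rewrite [x]xE; apply: abs_convex_sum => //.
  move: qx; rewrite qE; set N : R := (n + n)%:R => qx.
  have N0 : 0 < N by rewrite ltr0n addn_gt0 n0.
  (* The inequality of arithmetic and geometric means. *)
  have cN k : `|c x k| <= (N * c x k ^+ 2 + N^-1) / 2.
    rewrite -[c x k ^+ 2]real_normK ?num_real //; move: `|c x k| => u.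
    rewrite -subr_ge0.
    have -> : (N * u ^+ 2 + N^-1) / 2 - u = N / 2 * (u - N^-1) ^+ 2.
      by move: N N0 {qx} => N N0; field; rewrite gt_eqF.
    by rewrite mulr_ge0 ?sqr_ge0 // divr_ge0 // ltW.
  apply: le_trans (ler_sum _ (fun k _ => cN k)) _.
  rewrite -mulr_suml big_split /= -mulr_sumr sumr_const card_ord -[N^-1 *+ _]mulr_natl.
  by rewrite -/N divff ?gt_eqF //; lra.
Qed.

(** * Counting lattice points *)

Lemma set_card_le (T : choiceType) (F : finType) (X : set T) (g : T -> F) :
  finite_set X -> (forall x y, X x -> X y -> g x = g y -> x = y) ->
  (set_card X <= #|F|)%N.
Proof.
move=> Xfin gi; rewrite /set_card -(size_map g).
have /card_uniqP <- : uniq (map g (fset_set X)).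
  rewrite map_inj_in_uniq ?fset_uniq // => x y.
  by rewrite !in_fset_set // !inE; exact: gi.
exact: max_card.
Qed.

Lemma set_card_ge (T : choiceType) (F : finType) (X : set T) (f : F -> T) :
  finite_set X -> injective f -> (forall a, X (f a)) -> (#|F| <= set_card X)%N.
Proof.
move=> Xfin fi Xf; rewrite cardE -(size_map f).
apply: uniq_leq_size; first by rewrite map_inj_uniq ?enum_uniq.
by move=> _ /mapP[a _ ->]; rewrite in_fset_set // inE.
Qed.

Lemma card_box n (c : 'I_n -> nat) :
  #|{dffun forall i : 'I_n, 'I_(c i)}| = (\prod_i c i)%N.
Proof.
rewrite card_dep_ffun foldrE big_map big_enum /=.
by apply: eq_bigr => i _; rewrite card_ord.
Qed.

Lemma intvecK (R : realType) n : cancel (@intvec R n) (map_mx Num.floor).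
Proof. by move=> z; apply/colP => i; rewrite !mxE intrKfloor. Qed.

Lemma gap_card_ge (R : realType) n (A : 'M[int]_n) (b : 'cV[R]_n) :
  A \in unitmx -> (forall i, 0 <= b i 0) ->
  (\prod_i (2 * Num.truncn (b i 0%R)).+1 <= set_card (gap A b))%N.
Proof.
move=> Au b0; rewrite -card_box.
pose N i := Num.truncn (b i 0).
pose f (h : {dffun forall i : 'I_n, 'I_(2 * N i).+1}) : 'cV[R]_n :=
  intvec R (A *m \col_i ((h i : nat)%:Z - (N i)%:Z)).
apply: (set_card_ge (f := f)); first exact: finite_gap.
  move=> h h' /(can_inj (@intvecK R n)) /(congr1 (mulmx (invmx A))).
  rewrite !mulKmx // => /colP hh; apply/ffunP => i; apply: val_inj.
  by have := hh i; rewrite !mxE => /addIr [].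
move=> h; exists (\col_i ((h i : nat)%:Z - (N i)%:Z)) => //= i; rewrite mxE.
have /andP[Nb _] := truncn_itv (b0 i); apply: le_trans Nb.
rewrite -/(N i) -intr_norm -[leRHS]/((N i)%:Z%:~R) ler_int.
have : (h i < (2 * N i).+1)%N := ltn_ord (h i).
by rewrite ler_norml; move: (h i : nat) => a; move: (N i) => c; lia.
Qed.

(** The least exponent [e] with [2 / m < 2 ^ e]; being least, it is monotone in
    [m], and [2 ^ e] exceeds [2 / m] by a factor 2 at most unless it is 1. *)
Lemma pow2_above (R : archiRealFieldType) (m : R) : 0 < m -> exists e : nat,
  [/\ 2 < 2 ^+ e * m, (2 ^+ e <= 1 :> R) \/ 2 ^+ e * m <= 4 &
      forall e' : nat, 2 < 2 ^+ e' * m -> (e <= e')%N].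
Proof.
move=> m0; have ex : exists e : nat, (2 < 2 ^+ e * m :> R).
  exists (Num.bound (2 / m)); rewrite -ltr_pdivrMr //.
  apply: (@lt_trans _ _ (Num.bound (2 / m))%:R).
    by apply: archi_boundP; rewrite divr_ge0 // ltW.
  by rewrite -natrX ltr_nat ltn_expl.
case: (ex_minnP ex) => e eP emin; exists e; split=> //.
case: e eP emin => [|e] eP emin; first by left; rewrite expr0.
right; rewrite exprS -mulrA; have : ~~ (2 < 2 ^+ e * m).
  by apply/negP => /emin; rewrite ltnn.
by rewrite -leNgt; lra.
Qed.

(** Pigeonhole principle, after Henk.  If two points of [K] have coordinates
    congruent modulo the [2 ^ e i], then their difference, of length at most 2,
    has a last nonzero coordinate, with index [k] say.  As the moduli form a
    chain for divisibility, the difference is [2 ^ e k] times an integer vector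
    whose k-th coordinate is nonzero, hence of length at least [m k]: this
    contradicts [2 < 2 ^ e k * m k].  Powers of two are there to get
    divisibility from inequalities. *)
Lemma lattice_point_count (R : realType) n (Q : 'M[R]_n) A m
    (K : set 'cV[R]_n) (e : 'I_n -> nat) :
  posdef Q -> reduced Q A m -> compact K -> (forall x, K x -> qf Q x <= 1) ->
  (forall i, 2 < 2 ^+ e i * m i) ->
  (forall i j : 'I_n, (i <= j)%N -> (e j <= e i)%N) ->
  (set_card (K `&` int_lattice R n) <= \prod_i 2 ^ e i)%N.
Proof.
move=> pQ red Kc KQ em emono.
have Au := reduced_unit red.
under eq_bigr => i _ do rewrite -[(2 ^ _)%N]prednK ?expn_gt0 //.
rewrite -card_box.
pose zc (x : 'cV[R]_n) : 'cV[int]_n := invmx A *m map_mx Num.floor x.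
pose q i : int := (2 ^ e i)%N.
have q0 i : q i != 0 by rewrite /q eqz_nat expn_eq0.
pose g (x : 'cV[R]_n) : {dffun forall i : 'I_n, 'I_(2 ^ e i).-1.+1} :=
  [ffun i : 'I_n => inord `|(zc x i 0%R %% q i)%Z|%N].
apply: (set_card_le (g := g)); first exact: finite_lattice_points.
move=> x y [Kx [zx _ xE]] [Ky [zy _ yE]] gxy.
have zcE z : intvec R z = intvec R (A *m zc (intvec R z)).
  by rewrite /zc intvecK mulKVmx.
pose w := zc x - zc y.
have xyE : x - y = intvec R (A *m w).
  rewrite -xE -yE zcE [intvec R zy]zcE xE yE /w mulmxBr.
  by rewrite /intvec map_mxB.
have qw i : (q i %| w i 0%R)%Z.
  have /ffunP/(_ i) := gxy; rewrite !ffunE => /(congr1 val) /=.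
  have b z : (`|(z %% q i)%Z|%N < (2 ^ e i).-1.+1)%N.
    rewrite prednK ?expn_gt0 // -ltz_nat gez0_abs ?modz_ge0 // ltz_mod //.
  rewrite !inordK // => /(congr1 Posz); rewrite !gez0_abs ?modz_ge0 // => /eqP.
  by rewrite eqz_mod_dvd /w !mxE.
move: w xyE qw => w xyE qw; have [w0|w0] := eqVneq w 0.
  by apply/eqP; rewrite -subr_eq0 xyE w0 mulmx0 intvec_eq0.
have [i0 wi0] : exists i, w i 0 != 0.
  apply: contrapT => /forallNP h; move/eqP: w0; apply; apply/colP => i.
  rewrite mxE; apply/eqP/negPn/negP => wi.
  by apply: (h i).
case: (@arg_maxnP _ i0 (fun i => w i 0 != 0) (fun i => i : nat) wi0) => k wk kmax.
pose w' : 'cV[int]_n := \col_i (w i 0%R %/ q k)%Z.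
have ww' : w = q k *: w'.
  apply/colP => i; rewrite !mxE mulrC divzK //.
  have [ik|ki] := leqP i k.
    apply: (dvdz_trans _ (qw i)); rewrite /q dvdzE /= dvdn_exp2l //; exact: emono.
  have : ~~ (w i 0 != 0) by apply/negP => /kmax; rewrite /= leqNgt ki.
  by move=> /negPn/eqP ->; exact: dvdz0.
have w'k : w' k 0 != 0 by apply: contraNneq wk => h; rewrite ww' mxE h mulr0.
have := reduced_lower red w'k.
have qxy : qf Q (x - y) = (2 ^+ e k) ^+ 2 * qf Q (intvec R (A *m w')).
  rewrite xyE ww' -scalemxAr -qfZ; congr (qf _ _).
  by apply/colP => i; rewrite !mxE intrM; congr (_ * _); rewrite /q -natrX.
have [Qs _] := pQ.
have qle4 : qf Q (x - y) <= 4.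
  have := posdef_ge0 (x + y) pQ; rewrite -(scaleN1r y) !qfD // qfZ -scalemxAr.
  rewrite [X in _ + X *+ 2 + (-1) ^+ 2 * _]mxE.
  by have := KQ _ Kx; have := KQ _ Ky; rewrite sqrrN expr1n; lra.
move: qle4; rewrite qxy; have := em k.
have := reduced_gt0 red k; have : 0 < 2 ^+ e k :> R by rewrite exprn_gt0.
set E := 2 ^+ e k; move: (qf _ _) (m k) => u mk E0 mk0 h1 h2 h3.
exfalso; have : 2 ^+ 2 < (E * mk) ^+ 2 by rewrite ltr_pXn2r ?nnegrE ?mulr_ge0 ?ltW.
by rewrite exprMn; have := exprn_gt0 2 E0; nra.
Qed.

(** * The discrete John theorem *)

(** The right-hand side is [exp (2 n + 2 n ln 3 / ln n)], and [ln n <= n]. *)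
Lemma dilation_bound (R : realType) (n : nat) : (2 <= n)%N ->
  2 ^+ n * (2 * n%:R ^+ 2) <= (3 * n%:R) `^ (2 * n%:R / ln n%:R) :> R.
Proof.
move=> n2.
have n0 : 0 < n%:R :> R by rewrite ltr0n; lia.
have n1 : 1 < n%:R :> R by rewrite ltr1n.
have ln0 : 0 < ln (n%:R : R) by rewrite ln_gt0.
have lnn : ln (n%:R : R) <= n%:R.
  have := @le_ln1Dx R (n%:R - 1) _; rewrite addrCA subrr addr0.
  by move=> h; apply: (le_trans (h _)); lra.
have n3 : 0 < 3 * n%:R :> R by rewrite mulr_gt0.
rewrite /powR gt_eqF // lnM ?posrE //.
have -> : 2 * n%:R / ln n%:R * (ln 3 + ln n%:R) =
   n%:R * 2 + (n%:R / ln n%:R) * 2 * ln 3 :> R.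
  by field; rewrite gt_eqF.
rewrite expRD; apply: (@le_trans _ _ (4 ^+ n * 9)); last first.
  have e2 : 4 <= expR 2 :> R.
    have := expR_ge1Dx (1 : R); rewrite -[expR 2](_ : expR 1 ^+ 2 = _).
      by nra.
    by rewrite -expRM_natl mulr1.
  apply: ler_pM => //; first by rewrite expRM_natl lerXn2r ?nnegrE ?expR_ge0.
  have -> : (9 : R) = expR (2 * ln 3).
    by rewrite expRM_natl lnK ?posrE // expr2; ring.
  rewrite ler_expR ler_wpM2r ?ln_ge0 //; first by lra.
  by rewrite ler_peMl // ler_pdivlMr // mul1r.
have nn : (n ^ 2 <= 2 * 2 ^ n)%N.
  move: {n0 n1 ln0 lnn n3} n n2 => [|[|[|[|n]]]] // _.
  elim: n => // n IH; rewrite expnS mulnCA.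
  apply: leq_trans (leq_mul (leqnn 2) IH); rewrite !expnS !expn0; nia.
have {}nn : n%:R ^+ 2 <= 2 * 2 ^+ n :> R.
  by rewrite -!natrX -natrM ler_nat.
have -> : (4 : R) ^+ n = 2 ^+ n * 2 ^+ n.
  by rewrite -exprMn; congr (_ ^+ _); ring.
have : 0 < 2 ^+ n :> R by rewrite exprn_gt0.
by move: (2 ^+ n) nn => X; nra.
Qed.

Theorem theorem1p2 (R : realType) :
  exists C : R, 0 < C /\
    forall n : nat, (2 <= n)%N ->
    forall K : set 'cV[R]_n, symmetric_convex_body K ->
    exists (A : 'M[int]_n) (b : 'cV[R]_n),
      [/\ \det A != 0,
          gap A b `<=` K,
          K `&` int_lattice R n
            `<=` gap A ((C * n%:R) `^ (2 * n%:R / ln n%:R) *: b)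
        & (set_card (K `&` int_lattice R n))%:R
            < (C * n%:R) ^+ (2 * n) * (set_card (gap A b))%:R :> R].
Proof.
exists 3; split=> // n n2 K Ks.
have n0 : (0 < n)%N by exact: ltnW.
have nR0 : 0 < n%:R :> R by rewrite ltr0n.
have [Q [pQ KQ QK]] := john_ellipsoid n0 Ks.
have [A [m red]] := reduction_exists pQ.
have Au := reduced_unit red; have m0 := reduced_gt0 red.
pose s : R := 2 * n%:R ^+ 2; have s0 : 0 < s by rewrite mulr_gt0 ?exprn_gt0.
(* A vector with coordinates bounded by [b] has squared length at most
   [n ^ 3 / s ^ 2 = 1 / (4 n)], whereas [1 / (2 n)] suffices to be in [K]. *)
pose b : 'cV[R]_n := \col_i (s * m i)^-1.
have bE i : b i 0 = (s * m i)^-1 by rewrite mxE.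
have b0 i : 0 < b i 0 by rewrite bE invr_gt0 mulr_gt0.
exists A, b; split.
- by apply: contraTneq Au => A0; rewrite unitmxE A0 unitr0.
- move=> _ [z /= zb <-]; apply: QK.
  have : qf Q (intvec R (A *m z)) <= n%:R ^+ 3 * s^-1 ^+ 2.
    apply: (reduced_upper red) => k; rewrite -ler_pdivlMr //.
    by rewrite -invfM -bE.
  rewrite natrD -(ler_pM2l (_ : 0 < n%:R + n%:R :> R)) ?addr_gt0 // => /le_trans; apply.
  have -> : (n%:R + n%:R) * (n%:R ^+ 3 * s^-1 ^+ 2) = 2^-1 :> R.
    by rewrite /s; field; rewrite gt_eqF.
  lra.
- move=> x [Kx [z' _ zE]].
  have {}zE : intvec R (A *m (invmx A *m z')) = x by rewrite mulKVmx.
  move: (invmx A *m z') zE => z zE; exists z => // i; rewrite mxE.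
  have qz : qf Q (intvec R (A *m z)) <= 1 ^+ 2 by rewrite zE expr1n; exact: KQ.
  have := reduced_coord red ler01 qz; rewrite mulr1 (bigD1 i) //= => zi.
  have {}zi : `|(z i 0)%:~R| * m i <= 2 ^+ n.
    suff : 0 <= \sum_(k < n | k != i) `|(z k 0)%:~R| * m k by lra.
    by apply: sumr_ge0 => k _; rewrite mulr_ge0 // ltW.
  apply: (@le_trans _ _ (2 ^+ n * s * b i 0)).
    rewrite bE invfM mulrA mulfK ?gt_eqF // ler_pdivlMr //.
  by rewrite ler_wpM2r ?(ltW (b0 i)) //; exact: dilation_bound.
- have /choice[e eP] := fun i => pow2_above (m0 i).
  have eP1 i : 2 < 2 ^+ e i * m i by have [] := eP i.
  have emono (i j : 'I_n) : (i <= j)%N -> (e j <= e i)%N.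
    move=> ij; have [_ _] := eP j; apply; apply: lt_le_trans (eP1 i) _.
    by rewrite ler_wpM2l ?exprn_ge0 // (reduced_mono red).
  have Kc : compact K by have [] := Ks.
  have up := lattice_point_count pQ red Kc KQ eP1 emono.
  have lo := gap_card_ge Au (fun i => ltW (b0 i)).
  set P := set_card (gap A b) in lo *.
  have P0 : (0 < P)%N by apply: leq_trans lo; apply: prodn_gt0.
  (* A factor of order [n ^ 2] is lost in each coordinate. *)
  have fac i : (2 ^ e i)%:R <= 4 * s * (2 * Num.truncn (b i 0)).+1%:R :> R.
    rewrite natrX; have [_ h _] := eP i.
    set N := Num.truncn _; have N0 : 0 <= N%:R :> R by [].
    have NE : (2 * N).+1%:R = 2 * N%:R + 1 :> R by rewrite -natr1 natrM.
    have s1 : 1 <= s by have : 1 <= n%:R :> R; [rewrite ler1n|rewrite /s; nra].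
    case: h => [h|h]; first by apply: (le_trans h); rewrite NE; nra.
    have /andP[_ bN] := truncn_itv (ltW (b0 i)).
    apply: (@le_trans _ _ (4 * s * b i 0)).
      rewrite bE invfM mulrA mulfK ?gt_eqF // ler_pdivlMr //.
    rewrite ler_wpM2l ?mulr_ge0 ?(ltW s0) //; apply: ltW.
    by apply: lt_le_trans bN _; rewrite -/N ler_nat; lia.
  apply: (@le_lt_trans _ _ ((4 * s) ^+ n * P%:R)).
    apply: (@le_trans _ _ (\prod_i (2 ^ e i)%N)%:R); first by rewrite ler_nat.
    apply: (@le_trans _ _ ((4 * s) ^+ n *
      (\prod_i (2 * Num.truncn (b i 0%R)).+1)%N%:R)); last first.
      by rewrite ler_wpM2l ?exprn_ge0 ?mulr_ge0 ?(ltW s0) // ler_nat.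
    rewrite -[n in _ ^+ n]card_ord -prodr_const !natr_prod -big_split /=.
    by apply: ler_prod => i _; rewrite ler0n fac.
  rewrite ltr_pM2r ?ltr0n // exprM.
  rewrite ltr_pXn2r ?nnegrE ?exprn_ge0 ?mulr_ge0 ?(ltW s0) ?(ltW nR0) //.
  by rewrite /s exprMn; have := exprn_gt0 2 nR0; nra.
Qed.
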